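(* Let $r=\{r_j\}_{j=1}^\infty$ be a sequence of integers with $r_j\ge 2$ for each $j$, and let $R_n$, $Y_0$, $Y_n$ and the ultrametric $\rho$ be as defined in the context. Let $H^1$ denote one-dimensional Hausdorff measure on $Y_0$ with respect to $\rho$, and let $\mu_0$ be Haar measure on the compact commutative group $Y_0$ (under addition), normalized by $\mu_0(Y_0)=1$. Then $H^1(Y_n)=1/R_n$ for each $n\ge 0$, and $\mu_0$ is the same as $H^1$ on $Y_0$, that is, $\mu_0(E)=H^1(E)$ for every Borel set $E\subseteq Y_0$.
   Context: Let $r=\{r_j\}_{j=1}^\infty$ be a sequence of integers $\ge 2$; put $R_0=1$ and $R_l=\prod_{j=1}^l r_j$ for $l\ge 1$. Let $X_0=\prod_{l=1}^\infty(\mathbf{Z}/R_l\mathbf{Z})$, with coordinatewise addition and the product topology of the discrete topologies. Let $Y_0$ be the closed subgroup of coherent sequences in $X_0$, that is, sequences $\{x_l\}_{l=1}^\infty$ such that $x_l$ is the image of $x_{l+1}$ under the natural map $\mathbf{Z}/R_{l+1}\mathbf{Z}\to\mathbf{Z}/R_l\mathbf{Z}$ for each $l\ge 1$. For $n\ge 1$ let $Y_n$ be the set of $x\in Y_0$ with $x_n=0$ in $\mathbf{Z}/R_n\mathbf{Z}$. For distinct $x,y\in X_0$, let $l(x,y)$ be the smallest positive integer $l$ with $x_l\ne y_l$, and put $\rho(x,y)=1/R_{l(x,y)-1}$; put $\rho(x,x)=0$. This is a translation-invariant ultrametric on $X_0$ inducing the product topology, and it is restricted to $Y_0$. One-dimensional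 Hausdorff measure is normalized in the standard way by $H^1(E)=\lim_{\delta\to 0}\inf\{\sum_i\operatorname{diam}E_i : E\subseteq\bigcup_i E_i,\ \operatorname{diam}E_i<\delta\}$, over countable coverings. *)

(* Defs.v *)
From HB Require Import structures.
From mathcomp Require Import all_boot all_order all_algebra.
From mathcomp Require Import all_classical all_reals all_analysis.

Set Implicit Arguments.
Unset Strict Implicit.
Unset Printing Implicit Defensive.

Import Order.TTheory GRing.Theory Num.Theory.
Import numFieldNormedType.Exports.

Local Open Scope classical_set_scope.
Local Open Scope ring_scope.

(* Indices are shifted by one with respect to the usual notation: [r j] is
   r_{j+1}, and the coordinate [x l] of a point x is x_{l+1}, an element of
   Z/R_{l+1}Z.  The index n of [Rprod r n] = R_n is not shifted. *)
Definition Rprod (r : nat -> nat) (n : nat) : nat := \prod_(j < n) r j.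

Definition X0 (r : nat -> nat) : Type :=
  prod_topology (fun l : nat => discrete_topology 'Z_(Rprod r l.+1)).

HB.instance Definition _ r := Topological.on (X0 r).

Section X0_group.
Variable r : nat -> nat.
Implicit Types x y z : X0 r.

Definition X0_add x y : X0 r := fun l => (x l : 'Z_(Rprod r l.+1)) + y l.
Definition X0_opp x : X0 r := fun l => - (x l : 'Z_(Rprod r l.+1)).
Definition X0_zero : X0 r := fun l => (0 : 'Z_(Rprod r l.+1)).

Fact X0_addA : associative X0_add.
Proof. by move=> x y z; apply: functional_extensionality_dep => l; exact: addrA. Qed.
Fact X0_addC : commutative X0_add.
Proof. by move=> x y; apply: functional_extensionality_dep => l; exact: addrC. Qed.
Fact X0_add0 : left_id X0_zero X0_add.
Proof. by move=> x; apply: functional_extensionality_dep => l; exact: add0r. Qed.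
Fact X0_addN : left_inverse X0_zero X0_opp X0_add.
Proof. by move=> x; apply: functional_extensionality_dep => l; exact: addNr. Qed.

HB.instance Definition _ :=
  GRing.isZmodule.Build (X0 r) X0_addA X0_addC X0_add0 X0_addN.

End X0_group.

(* For d dividing n (and d, n >= 2), the natural map Z/nZ -> Z/dZ. *)
Definition Zreduce (n d : nat) (a : 'Z_n) : 'Z_d := (a : nat)%:R.

Definition coherent (r : nat -> nat) : set (X0 r) :=
  [set x | forall l, x l = Zreduce (Rprod r l.+1) (x l.+1)].
Arguments coherent r : clear implicits.

(* The proof [r_ge2] is a parameter of the type because the group law on it
   needs R_l >= 2 for l >= 1: in the library 'Z_0 and 'Z_1 are both Z/2Z. *)
Definition Y0 (r : nat -> nat) (r_ge2 : forall j, (2 <= r j)%N) : Type :=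
  set_type (coherent r).

HB.instance Definition _ r r_ge2 := Topological.on (@Y0 r r_ge2).
HB.instance Definition _ r r_ge2 := SubChoice.on (@Y0 r r_ge2).

Section Y0_group.
Variables (r : nat -> nat) (r_ge2 : forall j, (2 <= r j)%N).

Lemma Rprod_gt1 l : (1 < Rprod r l.+1)%N.
Proof.
rewrite /Rprod; elim: l => [|l IH]; first by rewrite big_ord1.
rewrite big_ord_recr /=; apply: (leq_trans IH).
by rewrite leq_pmulr// (leq_trans _ (r_ge2 _)).
Qed.

Lemma ZreduceB l (a b : 'Z_(Rprod r l.+2)) :
  Zreduce (Rprod r l.+1) (a - b) =
  Zreduce (Rprod r l.+1) a - Zreduce (Rprod r l.+1) b.
Proof.
have dvdR : (Rprod r l.+1 %| Rprod r l.+2)%N.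
  by rewrite /Rprod [X in (_ %| X)%N]big_ord_recr dvdn_mulr.
have H1 := Rprod_gt1 l; have H2 := Rprod_gt1 l.+1.
have red k : ((k %% Rprod r l.+2)%N%:R : 'Z_(Rprod r l.+1)) = k%:R.
  by apply: val_inj; rewrite /= !(val_Zp_nat H1) modn_dvdm.
have redD c d : Zreduce (Rprod r l.+1) (c + d : 'Z_(Rprod r l.+2)) =
    Zreduce (Rprod r l.+1) c + Zreduce (Rprod r l.+1) d.
  rewrite /Zreduce -natrD -[RHS]red; congr (_ %:R).
  by move: c d; rewrite /= Zp_cast.
by apply/eqP; rewrite eq_sym subr_eq -redD subrK.
Qed.

Fact coherent_zmod_closed : zmod_closed (mem (coherent r)).
Proof.
split; first by rewrite inE => l.
move=> x y; rewrite !inE => cx cy l.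
by rewrite [LHS](_ : _ = (x l : 'Z_(_)) - y l)// cx cy -ZreduceB.
Qed.

HB.instance Definition _ := GRing.SubChoice_isSubZmodule.Build
  (X0 r) (fun x => x \in coherent r) (Y0 r_ge2) coherent_zmod_closed.

End Y0_group.

Section Y0_topological_group.
Variables (r : nat -> nat) (r_ge2 : forall j, (2 <= r j)%N).

Lemma Y0_coord_near (x : Y0 r_ge2) l : \forall y \near x, val y l = val x l.
Proof.
have cv : {for x, continuous ((fun z : X0 r => z l) \o (val : Y0 r_ge2 -> X0 r))}.
  apply: continuous_comp; first exact: initial_continuous.
  exact: (@proj_continuous _ (fun l : nat => discrete_topology 'Z_(Rprod r l.+1))).
exact: (cv [set val x l] (discrete_set1 _)).
Qed.

Fact Y0_sub_continuous :
  continuous (fun xy : Y0 r_ge2 * Y0 r_ge2 => xy.1 - xy.2).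
Proof.
apply: (@continuous_comp_initial _ _ (X0 r) (val : Y0 r_ge2 -> X0 r)) => -[x y].
apply/cvg_sup => l A /= [_ [[B _ <-] /= Bxy] BA].
exists ([set z | val z l = val x l], [set z | val z l = val y l]).
  by split; exact: Y0_coord_near.
move=> [z t] [zt1 zt2]; apply: BA => /=.
have zx : val z l = val x l := zt1.
have ty : val t l = val y l := zt2.
have sub_coord (u v : Y0 r_ge2) : val (u - v) l = (val u l : 'Z_(_)) - val v l.
  by [].
have E : val (z - t) l = val (x - y) l by rewrite !sub_coord zx ty.
by have : B (val (z - t) l) by rewrite E.
Qed.

HB.instance Definition _ := PreTopologicalNmodule_isTopologicalZmodule.Build
  (Y0 r_ge2) Y0_sub_continuous.

End Y0_topological_group.

(* The group G with its Borel sigma-algebra, pointed by 0. *)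
Definition borel (G : topologicalZmodType) : Type := G.

Section borel_instance.
Variable G : topologicalZmodType.

HB.instance Definition _ := Choice.on (borel G).
HB.instance Definition _ := isPointed.Build (borel G) (0 : G).
HB.instance Definition _ := @isMeasurable.Build
  (sigma_display (@open G : set (set (borel G)))) (borel G) <<s @open G >>
  (@sigma_algebra0 _ setT (@open G))
  (@sigma_algebraC (borel G) (@open G)) (@sigma_algebra_bigcup _ setT (@open G)).

End borel_instance.

Section haar.
Local Open Scope ereal_scope.
Variables (R : realType) (G : topologicalZmodType).

(* A Haar measure is a nonzero translation-invariant Radon measure: finite on
   compact sets, outer regular on Borel sets, inner regular on open sets. *)
Record is_haar (mu : {measure set (borel G) -> \bar R}) : Prop := {
  haar_neq0 : mu setT != 0;
  haar_invariant : forall (a : G) (E : set (borel G)), measurable E ->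
    mu [set (a + x)%R | x in E] = mu E;
  haar_compact : forall K : set G, compact K -> mu K < +oo;
  haar_outer : forall E : set (borel G), measurable E ->
    mu E = ereal_inf [set mu U | U in [set U : set G | open U /\ E `<=` U]];
  haar_inner : forall U : set G, open U ->
    mu U = ereal_sup [set mu K | K in [set K : set G | compact K /\ K `<=` U]]
}.

End haar.

Section hausdorff_measure.
Local Open Scope ereal_scope.
Variables (R : realType) (T : Type) (rho : T -> T -> R).

(* The point 0 is added so that the empty set has diameter 0, and not -oo. *)
Definition diam (A : set T) : \bar R :=
  ereal_sup (0 |` [set (rho p.1 p.2)%:E | p in A `*` A]).

(* Finite coverings are included: pad with empty sets. *)
Definition hausdorff1_pre (delta : R) (E : set T) : \bar R :=
  ereal_inf [set \sum_(0 <= i <oo) diam (F i) | F in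
    [set F : (set T)^nat | E `<=` \bigcup_i F i /\
                           forall i, diam (F i) < delta%:E]].

Definition hausdorff1 (E : set T) : \bar R :=
  lim (hausdorff1_pre delta E @[delta --> 0^'+]).

End hausdorff_measure.

(* With shifted indices, l(x,y) - 1 is the least l such that [x l != y l]. *)
Definition rho (R : realType) (r : nat -> nat) (x y : X0 r) : R :=
  if pselect (exists l, x l != y l) is left xy
  then (Rprod r (ex_minn xy))%:R^-1 else 0.

Definition rhoY (R : realType) (r : nat -> nat)
    (r_ge2 : forall j, (2 <= r j)%N) (x y : Y0 r_ge2) : R :=
  rho R (val x) (val y).
Arguments rhoY R {r} r_ge2 x y.

Definition Yn (r : nat -> nat) (r_ge2 : forall j, (2 <= r j)%N) (n : nat) :
    set (Y0 r_ge2) :=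
  if n is m.+1 then [set x | val x m = (0 : 'Z_(Rprod r m.+1))] else setT.
Arguments Yn {r} r_ge2 n.

(* Main.v *)
Require Import Defs.
From mathcomp Require Import all_boot all_order all_algebra.
From mathcomp Require Import all_classical all_reals all_analysis.

(** Write R_k = r_1 ... r_k.  The balls of Y_0 are the cylinders, that is, the
    sets of points whose first k coordinates are prescribed: such a set has
    diameter at most 1/R_k, and it is a coset of Y_k.  The main point is that a
    Borel measure nu giving every such cylinder the mass 1/R_k must agree with
    H^1 wherever it is outer regular ([hausdorff1_eq]), for two reasons.

    - Mass distribution ([measure_le_hausdorff1_pre]): in an ultrametric space a
      set F lies in a closed ball of the same diameter, so that F has a
      measurable hull of mass at most diam F, and nu E is at most the sum of the
      diameters over any countable covering of E.
    - Efficient coverings ([hausdorff1_pre_open_le]): an open set U is a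
      countable disjoint union of cylinders of arbitrarily small diameters, and
      the sum of these diameters is at most the sum of the masses, which is nu U.

    Hence nu E <= H^1_delta(E) <= inf nu(U) over the open sets U containing E,
    for every delta > 0, and the right side is nu E by outer regularity.

    A normalized Haar measure has the required masses because Y_0 is the disjoint
    union of R_k translates of Y_k ([haar_cylinder]); this gives the second
    assertion.  In the first one no measure is given, so a measure nu with these
    masses is constructed ([uniform_measure_exists]): it is the image of Lebesgue
    measure on [0, 1) under the map that reads the digits of t in the mixed base
    r, most significant first, as the digits of a point of Y_0, least
    significant first.  As Y_n is open, H^1(Y_n) = nu(Y_n) = 1/R_n. *)

Set Implicit Arguments.
Unset Strict Implicit.
Unset Printing Implicit Defensive.

Import Order.TTheory GRing.Theory Num.Theory.
Import numFieldNormedType.Exports.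

Local Open Scope classical_set_scope.
Local Open Scope ring_scope.

(** * Cylinders and the topology of the group *)

Section cylinders.
Variables (r : nat -> nat) (r_ge2 : forall j, (2 <= r j)%N).
Local Notation Y := (Y0 r_ge2).
Implicit Types x y z : Y.

Lemma RprodS k : Rprod r k.+1 = (Rprod r k * r k)%N.
Proof. by rewrite /Rprod big_ord_recr. Qed.

Lemma ltn_Rprod k : (k < Rprod r k)%N.
Proof.
elim: k => [|k IH]; first by rewrite /Rprod big_ord0.
rewrite RprodS (leq_ltn_trans IH)// ltn_Pmulr// (leq_ltn_trans _ IH)//.
Qed.

Lemma Rprod_gt0 k : (0 < Rprod r k)%N.
Proof. exact: leq_ltn_trans (ltn_Rprod k). Qed.

Lemma leq_Rprod j k : (j <= k)%N -> (Rprod r j <= Rprod r k)%N.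
Proof.
move=> /subnK <-; elim: (k - j)%N => // i IH.
by rewrite addSn RprodS (leq_trans IH)// leq_pmulr// (leq_trans _ (r_ge2 _)).
Qed.

Definition cylinder x (k : nat) : set Y :=
  [set y | forall l, (l < k)%N -> val y l = val x l].

Lemma coherentP x l : val x l = Zreduce (Rprod r l.+1) (val x l.+1).
Proof. by move: (valP x); rewrite inE; apply. Qed.

(** By coherence, a coordinate determines all the previous ones. *)
Lemma eq_coord_le x y j k :
  (j <= k)%N -> val y k = val x k -> val y j = val x j.
Proof.
move=> /subnK <-; elim: (k - j)%N => // i IH; rewrite addSn => yx.
by apply: IH; rewrite [LHS]coherentP yx -coherentP.
Qed.

Lemma cylinder0 x : cylinder x 0 = setT.
Proof. by apply/seteqP; split. Qed.

Lemma cylinderS x k : cylinder x k.+1 = [set y | val y k = val x k].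
Proof.
apply/seteqP; split=> y /=; first by apply.
by move=> yx l /ltnSE lk; exact: eq_coord_le yx.
Qed.

Lemma cylinder_eq x y k : cylinder x k y -> cylinder y k = cylinder x k.
Proof.
move=> xy; apply/seteqP; split=> z zy l lk; first by rewrite zy// xy.
by rewrite zy// xy.
Qed.

Lemma cylinder_le x j k : (j <= k)%N -> cylinder x k `<=` cylinder x j.
Proof. by move=> jk y yx l lj; apply: yx; exact: leq_trans jk. Qed.

Lemma cylinder_open x k : open (cylinder x k).
Proof.
case: k => [|k]; first by rewrite cylinder0; exact: openT.
rewrite cylinderS openE => y /= yx.
by apply: filterS (Y0_coord_near y k) => z zy; exact: etrans zy yx.
Qed.

(** The k-th cylinders around x form a filter base converging to x: the topology
    is initial for the coordinates, and each coordinate is constant on the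
    cylinders of high level. *)
Lemma cylinder_basis (U : set Y) x : open U -> U x ->
  exists k, cylinder x k `<=` U.
Proof.
move=> oU Ux.
pose F := filter_from [set: nat] (cylinder x).
have FF : Filter F.
  apply: filter_from_filter => [|i j _ _]; first by exists 0%N.
  exists (maxn i j) => // y yx.
  by split; apply: cylinder_le yx; rewrite ?leq_maxl ?leq_maxr.
have [V oV VU] := oU.
suff : fmap (val : Y -> X0 r) F --> (val x : X0 r).
  move=> /(_ V) /=.
  have nV : nbhs (val x : X0 r) V.
    by apply: open_nbhs_nbhs; split => //; rewrite -VU in Ux.
  move=> /(_ nV) [k _ kV]; exists k; rewrite -VU.
  exact: kV.
apply/cvg_sup => l A /= [_ [[B oB <-] /= Bx] BA].
exists l.+1 => // y yx; apply: BA => /=.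
have yxl : val y l = val x l by exact: yx.
by have : B (val y l) by rewrite yxl.
Qed.

End cylinders.

(** * Cylinders as balls of the ultrametric *)

Section metric.
Variables (R : realType) (r : nat -> nat) (r_ge2 : forall j, (2 <= r j)%N).
Local Notation Y := (Y0 r_ge2).
Implicit Types x y z : Y.

Definition cylradius (k : nat) : R := (Rprod r k)%:R^-1.

Lemma cylradius_gt0 k : 0 < cylradius k.
Proof. by rewrite invr_gt0 ltr0n Rprod_gt0. Qed.

Lemma cylradius_le j k : (j <= k)%N -> cylradius k <= cylradius j.
Proof.
move=> jk; rewrite lef_pV2 ?posrE ?ltr0n ?(Rprod_gt0 r_ge2)//.
by rewrite ler_nat leq_Rprod.
Qed.

Lemma cylradius_small (e : R) : 0 < e -> exists k, cylradius k < e.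
Proof.
move=> e0; exists (Num.truncn e^-1).
rewrite invf_plt ?posrE ?ltr0n ?(Rprod_gt0 r_ge2)//.
by rewrite (lt_le_trans (truncnS_gt _))// ler_nat ltn_Rprod.
Qed.

Lemma rho_cylinder x y z k : cylinder x k y -> cylinder x k z ->
  rhoY R r_ge2 y z <= cylradius k.
Proof.
move=> xy xz; rewrite /rhoY /rho; case: pselect => [yz|_]; last first.
  exact/ltW/cylradius_gt0.
case: ex_minnP => l yzl _; apply: cylradius_le; rewrite leqNgt.
by apply/negP => lk; move: yzl; rewrite xy// xz// eqxx.
Qed.

(** The only distances are 0 and the 1/R_l, so that a distance less than 1/R_k
    is at most 1/R_(k+1): this gains one coordinate. *)
Lemma cylinder_rho x y k : rhoY R r_ge2 x y < cylradius k -> cylinder x k.+1 y.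
Proof.
move=> xyk l lk; apply/eqP; rewrite eq_sym; apply/negPn/negP => xyl.
move: xyk; rewrite /rhoY /rho; case: pselect => [xy|[]]; last by exists l.
case: ex_minnP => m _ /(_ _ xyl) ml; apply/negP; rewrite -leNgt.
by apply: cylradius_le; exact: leq_trans ml _.
Qed.

End metric.

(** * Hausdorff measure and measures giving cylinders their diameters *)

Section diam.
Local Open Scope ereal_scope.
Variables (R : realType) (T : Type) (d : T -> T -> R).

Lemma diam_ge0 A : 0 <= diam d A.
Proof. by apply: ereal_sup_ubound; left. Qed.

Lemma diam_ge A x y : A x -> A y -> (d x y)%:E <= diam d A.
Proof. by move=> Ax Ay; apply: ereal_sup_ubound; right; exists (x, y). Qed.

Lemma diam_le A (e : \bar R) : 0 <= e ->
  (forall x y, A x -> A y -> (d x y)%:E <= e) -> diam d A <= e.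
Proof.
move=> e0 Ae; apply: ge_ereal_sup => _ [->//|[[x y] /= [Ax Ay] <-]].
exact: Ae.
Qed.

End diam.

Section comparison.
Local Open Scope ereal_scope.
Variables (R : realType) (r : nat -> nat) (r_ge2 : forall j, (2 <= r j)%N).
Local Notation Y := (Y0 r_ge2).
Local Notation d := (rhoY R r_ge2).
Variable nu : {measure set (borel Y) -> \bar R}.
Hypothesis nu_cylinder :
  forall (x : Y) k, nu (cylinder x k) = (cylradius R r k)%:E.

Lemma open_measurable_borel (G : topologicalZmodType) (U : set G) :
  open U -> measurable (U : set (borel G)).
Proof. exact: sub_sigma_algebra. Qed.

Lemma diam_cylinder (x : Y) k : diam d (cylinder x k) <= (cylradius R r k)%:E.
Proof.
apply: diam_le => [|y z xy xz]; first by rewrite lee_fin ltW ?cylradius_gt0.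
by rewrite lee_fin; exact: rho_cylinder xy xz.
Qed.

(** The hull is the intersection of the cylinders around a point of F that
    contain F.  If its mass were greater than diam F, then whenever the cylinder
    of level k contains F, its mass 1/R_k would exceed diam F, and the cylinder
    of level k + 1 would contain F as well.  Hence all of them would contain F,
    and the hull would have mass at most 1/R_k for every k, that is, mass 0. *)
Lemma measure_hull (F : set Y) :
  exists B : set (borel Y), [/\ measurable B, F `<=` B & nu B <= diam d F].
Proof.
have [->|/set0P[x Fx]] := eqVneq F set0.
  exists set0; rewrite measure0; split => //; exact: diam_ge0.
pose K := [set k | F `<=` cylinder x k].
pose B := \bigcap_(k in K) cylinder x k.
have mC k : measurable (cylinder x k : set (borel Y)).
  by apply: open_measurable_borel; exact: cylinder_open.
have mB : measurable (B : set (borel Y)) by exact: bigcap_measurableType.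
exists B; split => // [y Fy k /(_ y Fy)//|].
have nuB k : K k -> nu B <= (cylradius R r k)%:E.
  by move=> Kk; rewrite -(nu_cylinder x k) le_measure ?inE//; exact: bigcap_inf.
rewrite leNgt; apply/negP => dB.
have KT k : K k.
  elim: k => [|k Kk]; first by rewrite /K /= cylinder0.
  move=> y Fy; apply: (@cylinder_rho R).
  rewrite -lte_fin (le_lt_trans (diam_ge d Fx Fy))//.
  exact: lt_le_trans dB (nuB _ Kk).
have nuB0 : 0 < nu B by exact: le_lt_trans (diam_ge0 _ _) dB.
have : nu B < +oo by rewrite (le_lt_trans (nuB 0%N _)) ?ltry.
move: nuB0 nuB; case: (nu B) => // e; rewrite lte_fin => e0 nuB _.
have [k /lt_geF] := cylradius_small r_ge2 e0.
by rewrite -lee_fin nuB.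
Qed.

Lemma measure_le_hausdorff1_pre (E : set (borel Y)) (delta : R) :
  measurable E -> nu E <= hausdorff1_pre d delta E.
Proof.
move=> mE; apply: le_ereal_inf_tmp => _ [F [EF _] <-].
have [B BF] := choice (fun i => measure_hull (F i)).
apply: (@le_trans _ _ (\sum_(0 <= i <oo) nu (B i))).
  apply: measure_sigma_subadditive => // [i|]; first by have [] := BF i.
  by apply: subset_trans EF _; apply: subset_bigcup => i _; have [] := BF i.
by apply: lee_nneseries => i _; have [] := BF i.
Qed.

(** Every point of an open set U lies in a largest cylinder of level at least
    k0 + 1 contained in U; these cylinders partition U. *)
Section maximal_cylinders.
Variables (U : set Y) (k0 : nat).
Hypothesis oU : open U.

Definition maximal_level (x : Y) (k : nat) :=
  [/\ (k0 <= k)%N, cylinder x k.+1 `<=` U &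
      forall j, (k0 <= j < k)%N -> ~ cylinder x j.+1 `<=` U].

Lemma maximal_level_exists x : U x -> exists k, maximal_level x k.
Proof.
move=> Ux; have [k kU] := cylinder_basis oU Ux.
pose P j := (k0 <= j)%N && `[< cylinder x j.+1 `<=` U >].
have exP : exists j, P j.
  exists (maxn k0 k); rewrite /P leq_maxl; apply/asboolP.
  apply: subset_trans kU; apply: cylinder_le.
  by rewrite (leq_trans (leq_maxr k0 k)).
exists (ex_minn exP); case: ex_minnP => j /andP[k0j /asboolP jU] jmin.
split => // i /andP[k0i ij] iU; move: (jmin i); rewrite leqNgt ij.
by rewrite /P k0i/= => /(_ (asboolT iU)).
Qed.

Lemma maximal_level_unique x j k :
  maximal_level x j -> maximal_level x k -> j = k.
Proof.
move=> [k0j jU jmin] [k0k kU kmin].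
have [jk|kj|//] := ltngtP j k.
- by case: (kmin j) => //; rewrite k0j.
- by case: (jmin k) => //; rewrite k0k.
Qed.

Lemma maximal_level_cylinder x y k :
  cylinder x k.+1 y -> maximal_level x k -> maximal_level y k.
Proof.
move=> xy [k0k kU kmin]; split => //; first by rewrite (cylinder_eq xy).
move=> j /[dup] /andP[_ jk] /kmin; rewrite (@cylinder_eq _ _ x y)//.
by apply: cylinder_le xy; exact: ltnW.
Qed.

(** The maximal cylinders, numbered by the pairs (level k, value a of the k-th
    coordinate) that determine them; the other numbers give the empty set.  The
    sharp inverse [pickle_inv] is needed for distinct numbers to stand for
    distinct pairs, hence for disjoint pieces. *)
Definition piece (i : nat) : set Y :=
  if pickle_inv i is Some (k, a) then
    [set x | maximal_level x k /\ (val x k : nat) = a]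
  else set0.

Lemma piece_cases i : piece i = set0 \/
  exists x k, (k0 <= k)%N /\ piece i = cylinder x k.+1.
Proof.
rewrite /piece; case: pickle_inv => [[k a]|]; last by left.
set D := mkset _.
have [->|/set0P[x [xk xa]]] := eqVneq D set0; [by left|right].
exists x, k; split; first by case: xk.
apply/seteqP; split => y; rewrite cylinderS /=.
  by move=> [_ ya]; apply: val_inj; exact: etrans ya (esym xa).
move=> yx; split; last exact: etrans (congr1 val yx) xa.
by apply: maximal_level_cylinder xk; rewrite cylinderS.
Qed.

Lemma bigcup_piece : \bigcup_i piece i = U.
Proof.
apply/seteqP; split => [x [i _]|x Ux].
  rewrite /piece; case: pickle_inv => [[k a]|]//= [[_ kU _] _]; exact: kU.
have [k xk] := maximal_level_exists Ux.
by exists (pickle (k, val x k : nat)) => //; rewrite /piece pickleK_inv.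
Qed.

Lemma trivIset_piece : trivIset setT piece.
Proof.
apply/trivIsetP => i j _ _ ij; apply/seteqP; split => // x [].
rewrite /piece.
have := @pickle_invK (nat * nat)%type i.
have := @pickle_invK (nat * nat)%type j.
case: (pickle_inv j) => [[l b]|]//= jE; case: (pickle_inv i) => [[k a]|]//= iE.
move=> [xk xa] [xl xb]; have kl := maximal_level_unique xk xl.
by move/eqP: ij; apply; rewrite -iE -jE -xa -xb kl.
Qed.

End maximal_cylinders.

(** The maximal cylinders of high level form a disjoint covering of U that is
    admissible for delta and whose diameters are at most the masses. *)
Lemma hausdorff1_pre_open_le (U : set Y) (delta : R) :
  open U -> (0 < delta)%R -> hausdorff1_pre d delta U <= nu U.
Proof.
move=> oU delta0; have [k0 k0delta] := cylradius_small r_ge2 delta0.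
pose F := piece U k0.
have mF i : measurable (F i : set (borel Y)).
  apply: open_measurable_borel; rewrite /F.
  have [->|[x [k [_ ->]]]] := piece_cases U k0 i; first exact: open0.
  exact: cylinder_open.
have dF i : diam d (F i) <= nu (F i) /\ diam d (F i) < delta%:E.
  rewrite /F; have [->|[x [k [k0k ->]]]] := piece_cases U k0 i.
    have d0 : diam d set0 <= 0 by exact: diam_le.
    by rewrite measure0 d0 (le_lt_trans d0).
  rewrite nu_cylinder diam_cylinder; split => //.
  rewrite (le_lt_trans (diam_cylinder _ _))// lte_fin (le_lt_trans _ k0delta)//.
  by apply: cylradius_le => //; exact: leqW.
apply: (@le_trans _ _ (\sum_(0 <= i <oo) diam d (F i))).
  apply: ereal_inf_lbound; exists F => //.
  split => [|i]; last by have [] := dF i.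
  by rewrite /F bigcup_piece.
rewrite -(bigcup_piece k0 oU).
rewrite (measure_bigcup nu setT F)//; last exact: trivIset_piece.
rewrite [leRHS](@eq_eseriesl _ _ xpredT); last by move=> i; rewrite in_setT.
by apply: lee_nneseries => [i _ _|i _]; [exact: diam_ge0|have [] := dF i].
Qed.

(** The approximations of H^1(E) at scale delta do not depend on delta: they are
    all squeezed between nu E and the masses of the open sets containing E. *)
Lemma hausdorff1_eq (E : set (borel Y)) : measurable E ->
  nu E = ereal_inf [set nu U | U in [set U : set Y | open U /\ E `<=` U]] ->
  hausdorff1 d E = nu E.
Proof.
move=> mE nuE; apply: lim_near_cst => //; near=> delta.
have delta0 : (0 < delta)%R by near: delta; exact: nbhs_right_gt.
apply/eqP; rewrite eq_le measure_le_hausdorff1_pre// andbT nuE.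
apply: le_ereal_inf_tmp => _ [U [oU EU] <-].
apply: le_trans (hausdorff1_pre_open_le oU delta0).
apply: ereal_inf_le_tmp => _ [F [UF dF] <-]; exists F => //.
by split => //; exact: subset_trans UF.
Unshelve. all: by end_near. Qed.

Lemma hausdorff1_open (U : set Y) : open U -> hausdorff1 d U = nu U.
Proof.
move=> oU; have mU := open_measurable_borel oU.
rewrite hausdorff1_eq//; apply/eqP; rewrite eq_le; apply/andP; split.
  apply: le_ereal_inf_tmp => _ [V [oV UV] <-].
  by apply: le_measure => //; rewrite inE//; exact: open_measurable_borel.
by apply: ereal_inf_lbound; exists U => //; split.
Qed.

End comparison.

(** * Haar measure of cylinders *)

Section coherent_naturals.
Variables (r : nat -> nat) (r_ge2 : forall j, (2 <= r j)%N).
Local Notation Y := (Y0 r_ge2).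

Lemma natr_Z_eq k a b : (a%:R == b%:R :> 'Z_(Rprod r k.+1)) =
  (a == b %[mod Rprod r k.+1])%N.
Proof. by rewrite -val_eqE /= !(val_Zp_nat (Rprod_gt1 r_ge2 k)). Qed.

Lemma coherent_of_nat (N : nat -> nat) :
  (forall l, N l.+1 = N l %[mod Rprod r l.+1])%N ->
  (fun l => (N l)%:R) \in coherent r.
Proof.
move=> NS; rewrite inE => l /=; rewrite /Zreduce.
apply/eqP; rewrite natr_Z_eq (val_Zp_nat (Rprod_gt1 r_ge2 _)).
by rewrite modn_dvdm ?NS// [X in (_ %| X)%N]RprodS dvdn_mulr.
Qed.

(** The point of Y_0 whose coordinates are the classes of natural numbers that
    need not be reduced; a constant sequence gives the image of an integer. *)
Definition of_nat (N : nat -> nat)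
    (NS : forall l, (N l.+1 = N l %[mod Rprod r l.+1])%N) : Y :=
  exist _ (fun l => (N l)%:R) (coherent_of_nat NS).

Lemma val_of_nat N NS l : val (@of_nat N NS) l = (N l)%:R.
Proof. by []. Qed.

End coherent_naturals.

Section haar_cylinders.
Local Open Scope ereal_scope.
Variables (R : realType) (r : nat -> nat) (r_ge2 : forall j, (2 <= r j)%N).
Local Notation Y := (Y0 r_ge2).

Lemma translate_cylinder (x : Y) k :
  [set (x + y)%R | y in cylinder 0%R k] = cylinder x k.
Proof.
apply/seteqP; split => [_ [y y0 <-] l lk|y yx].
  rewrite [LHS](_ : _ = (val x l : 'Z_(_)) + val y l)%R// y0//.
  exact: addr0.
exists (y - x)%R; last by rewrite addrC subrK.
move=> l lk; rewrite [LHS](_ : _ = (val y l : 'Z_(_)) - val x l)%R// yx//.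
exact: subrr.
Qed.

(** The R_k cosets of Y_k are represented by the integers a < R_k, and they are
    translates of each other, so that each has mass 1/R_k. *)
Lemma haar_cylinder (mu : {measure set (borel Y) -> \bar R}) :
  is_haar mu -> mu setT = 1 ->
  forall (x : Y) k, mu (cylinder x k) = (cylradius R r k)%:E.
Proof.
move=> haar muT x [|k].
  by rewrite cylinder0 muT /cylradius /Rprod big_ord0 invr1.
have mC (y : Y) : measurable (cylinder y k.+1 : set (borel Y)).
  by apply: open_measurable_borel; exact: cylinder_open.
have muC (y : Y) : mu (cylinder y k.+1) = mu (cylinder (0%R : Y) k.+1).
  by rewrite -(translate_cylinder y) (haar_invariant haar).
pose F (a : nat) : set Y := [set y | val y k = a%:R].
have FE a : F a =
    cylinder (of_nat r_ge2 (fun l => erefl (a %% Rprod r l.+1)%N)) k.+1.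
  by rewrite cylinderS.
have FT : \bigcup_(a < Rprod r k.+1) F a = setT.
  apply/seteqP; split => // y _; exists (val y k : nat); last first.
    by rewrite /F /= natr_Zp.
  rewrite /= -[X in (_ < X)%N](Zp_cast (Rprod_gt1 r_ge2 k)); exact: ltn_ord.
have tF : trivIset `I_(Rprod r k.+1) F.
  apply/trivIsetP => a b /= aR bR ab; apply/seteqP; split => // y [ya yb].
  move/eqP: ab; apply; apply/eqP.
  rewrite -(modn_small aR) -(modn_small bR) -(natr_Z_eq r_ge2).
  by apply/eqP; exact: etrans (esym ya) yb.
have := muT; rewrite -FT measure_fin_bigcup//; last first.
  by move=> a _; rewrite FE.
rewrite -fsbig_ord /=.
rewrite (eq_bigr (fun=> mu (cylinder (0%R : Y) k.+1))); last first.
  by move=> a _; rewrite FE muC.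
have fin0 : mu (cylinder (0%R : Y) k.+1) \is a fin_num.
  rewrite ge0_fin_numE// (@le_lt_trans _ _ 1) ?ltry//.
  by rewrite -muT le_measure ?inE.
rewrite muC -(fineK fin0) sumr_const card_ord.
move=> /(etrans (EFin_natmul _ _))[cR].
congr EFin; rewrite /cylradius; apply: (@mulIf _ (Rprod r k.+1)%:R).
  by rewrite pnatr_eq0 -lt0n (Rprod_gt0 r_ge2).
by rewrite mulr_natr cR mulVf// pnatr_eq0 -lt0n (Rprod_gt0 r_ge2).
Qed.

End haar_cylinders.

(** * Lebesgue measure transported by digit reversal *)

Section digit_reversal.
Variables (r : nat -> nat) (r_ge2 : forall j, (2 <= r j)%N).

(** If q = e_0 r_2...r_k + ... + e_(k-2) r_k + e_(k-1) with digits e_j < r_(j+1),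
    then the reversal of q is e_0 + e_1 R_1 + ... + e_(k-1) R_(k-1). *)
Fixpoint digit_rev (k q : nat) : nat :=
  if k is j.+1 then (digit_rev j (q %/ r j) + q %% r j * Rprod r j)%N else 0%N.

Lemma digit_rev_lt k q : (digit_rev k q < Rprod r k)%N.
Proof.
elim: k q => [|k IH] q /=; first by rewrite /Rprod big_ord0.
rewrite RprodS; have qr : (q %% r k < r k)%N.
  by rewrite ltn_mod (leq_trans _ (r_ge2 k)).
rewrite (@leq_trans ((q %% r k).+1 * Rprod r k))//.
  by rewrite mulSn ltn_add2r.
by rewrite mulnC leq_mul2l qr orbT.
Qed.

Lemma digit_revS_mod k q :
  (digit_rev k.+1 q = digit_rev k (q %/ r k) %[mod Rprod r k])%N.
Proof. by rewrite /= addnC modnMDl. Qed.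

(** Modulo R_k, the reversal of q with respect to k + 1 digits is the reversal
    of q without its last digit, and its quotient by R_k is this last digit;
    hence the preimage m is built by induction. *)
Lemma digit_rev_bij k a : (a < Rprod r k)%N -> exists2 m,
  (m < Rprod r k)%N & forall q, (q < Rprod r k)%N ->
    (digit_rev k q == a) = (q == m).
Proof.
elim: k a => [|k IH] a.
  rewrite /Rprod big_ord0 ltnS leqn0 => /eqP ->; exists 0%N => // q.
  by rewrite ltnS leqn0 => /eqP ->.
have r0 : (0 < r k)%N by exact: leq_trans (r_ge2 k).
have R0 : (0 < Rprod r k)%N by exact: Rprod_gt0.
rewrite RprodS => aR.
have [m mR mP] := IH (a %% Rprod r k)%N (ltn_pmod _ R0).
have er : (a %/ Rprod r k < r k)%N by rewrite ltn_divLR// mulnC.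
exists (m * r k + a %/ Rprod r k)%N.
  rewrite (@leq_trans (m.+1 * r k))// ?leq_mul2r ?mR ?orbT//.
  by rewrite mulSn addnC ltn_add2r.
move=> q qR.
have qR' : (q %/ r k < Rprod r k)%N by rewrite ltn_divLR.
apply/eqP/eqP => [qa|->]; last first.
  rewrite /= divnMDl// modnMDl (divn_small er) addn0 (modn_small er).
  by have := mP m mR; rewrite eqxx => /eqP ->; rewrite addnC -divn_eq.
have revE : (digit_rev k.+1 q %% Rprod r k = digit_rev k (q %/ r k))%N.
  by rewrite digit_revS_mod modn_small ?digit_rev_lt.
have -> : m = (q %/ r k)%N by apply/esym/eqP; rewrite -mP// -qa revE.
rewrite -qa /= [X in (X %/ Rprod r k)%N]addnC divnMDl//.
rewrite (divn_small (digit_rev_lt k _)) addn0.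
exact: divn_eq.
Qed.

End digit_reversal.

Section reversed_lebesgue.
Variables (R : realType) (r : nat -> nat) (r_ge2 : forall j, (2 <= r j)%N).
Local Notation Y := (Y0 r_ge2).

Lemma truncnM_divn (x : R) n : (0 < n)%N ->
  (Num.truncn (x * n%:R) %/ n)%N = Num.truncn x.
Proof.
move=> n0; have [x0|x0] := leP 0 x; last first.
  have lt1 (z : R) : z < 0 -> Num.truncn z = 0%N.
    by move=> z0; apply/truncn0Pn; rewrite -ltNge (lt_trans z0).
  by rewrite !lt1 ?div0n// pmulr_llt0 ?ltr0n.
have H m : (m <= Num.truncn (x * n%:R) %/ n)%N = (m <= Num.truncn x)%N.
  rewrite leq_divRL// !truncn_ge_nat ?mulr_ge0// natrM ler_pM2r//.
  by rewrite ltr0n.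
by apply/eqP; rewrite eqn_leq -H leqnn H leqnn.
Qed.

(** The number of the interval [m/R_k, (m+1)/R_k) that contains t, for t >= 0. *)
Definition cell (k : nat) (t : R) : nat := Num.truncn (t * (Rprod r k)%:R).

Lemma cell_divn k t : (cell k.+1 t %/ r k)%N = cell k t.
Proof.
by rewrite /cell RprodS natrM mulrA truncnM_divn// (leq_trans _ (r_ge2 k)).
Qed.

(** Passing from t R_l to t R_(l+1) appends a least significant digit, which
    reversal turns into a multiple of R_l. *)
Lemma digit_rev_cell_coherent t l :
  (digit_rev r l.+2 (cell l.+2 t) = digit_rev r l.+1 (cell l.+1 t)
     %[mod Rprod r l.+1])%N.
Proof. by rewrite digit_revS_mod cell_divn. Qed.

Definition reversal (t : R) : Y := of_nat r_ge2 (digit_rev_cell_coherent t).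

Lemma coord_lt (x : Y) k : (val x k < Rprod r k.+1)%N.
Proof.
by rewrite -[X in (_ < X)%N](Zp_cast (Rprod_gt1 r_ge2 k)); exact: ltn_ord.
Qed.

Lemma reversal_cylinder (x : Y) k :
  reversal @^-1` cylinder x k.+1 =
  [set t | digit_rev r k.+1 (cell k.+1 t) = val x k].
Proof.
rewrite cylinderS; apply/seteqP; split => t; rewrite /mkset.
  move=> tx; have /eqP : (digit_rev r k.+1 (cell k.+1 t))%:R =
      (val x k : nat)%:R :> 'Z_(Rprod r k.+1) by rewrite natr_Zp.
  by rewrite natr_Z_eq// !modn_small ?coord_lt ?digit_rev_lt// => /eqP.
move=> tx; rewrite /preimage /mkset val_of_nat tx.
exact: (@natr_Zp _ (val x k)).
Qed.

Lemma measurable_cell k (P : set nat) : measurable [set t : R | P (cell k t)].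
Proof.
have R0 : 0 < (Rprod r k)%:R :> R by rewrite ltr0n (Rprod_gt0 r_ge2).
have mlt n : measurable [set t : R | (cell k t < n)%N].
  case: n => [|n]; first by rewrite (_ : mkset _ = set0)//; apply/seteqP; split.
  rewrite (_ : mkset _ = `]-oo, n.+1%:R / (Rprod r k)%:R[%classic)//.
  apply/seteqP; split => t /=; rewrite in_itv/= ltr_pdivlMr//.
    by rewrite ltnS truncn_le_nat.
  by rewrite ltnS truncn_le_nat.
rewrite (_ : mkset _ = \bigcup_(n in P)
    ([set t | (cell k t < n.+1)%N] `\` [set t | (cell k t < n)%N])).
  by apply: bigcup_measurable => n _; exact: measurableD.
apply/seteqP; split => [t Pt|t [n Pn [/= tn /negP]]].
  by exists (cell k t) => //=; split => //; rewrite ltnn.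
rewrite -leqNgt => nt; rewrite (_ : cell k t = n)//.
by apply/eqP; rewrite eqn_leq nt -ltnS tn.
Qed.

(** Open sets are countable unions of cylinders, whose preimages are unions of
    cells. *)
Lemma measurable_reversal :
  measurable_fun [set: R] (reversal : R -> borel Y).
Proof.
apply: (@measurability _ _ _ (borel Y) setT reversal (@open Y)) => //.
move=> _ [U oU <-]; rewrite setTI -(bigcup_piece 0 oU) preimage_bigcup.
apply: bigcup_measurable => i _.
have [->|[x [k [_ ->]]]] := piece_cases U 0 i; first by rewrite preimage_set0.
rewrite reversal_cylinder.
exact: (measurable_cell k.+1 [set q | digit_rev r k.+1 q = val x k]).
Qed.

(** Reversal permutes the numbers below R_k, so that the preimage of a cylinder
    of level k in [0, 1) is exactly one cell. *)
Lemma lebesgue_reversal_cylinder (x : Y) k :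
  lebesgue_measure (reversal @^-1` cylinder x k `&` `[0, 1[%classic) =
  (cylradius R r k)%:E.
Proof.
have R0 : 0 < (Rprod r k)%:R :> R by rewrite ltr0n (Rprod_gt0 r_ge2).
suff [m mR ->] : exists2 m, (m < Rprod r k)%N &
    reversal @^-1` cylinder x k `&` `[0, 1[ =
    `[m%:R / (Rprod r k)%:R, m.+1%:R / (Rprod r k)%:R[%classic.
  rewrite lebesgue_measure_itv/= lte_fin ltr_pM2r ?invr_gt0// ltr_nat ltnS leqnn.
  by rewrite -EFinD -mulrBl -natrB// subSnn mul1r.
case: k R0 => [|k] R0.
  exists 0%N; first exact: (Rprod_gt0 r_ge2).
  by rewrite cylinder0 preimage_setT setTI /Rprod big_ord0 mul0r divr1.
have [m mR mP] := digit_rev_bij r_ge2 (coord_lt x k).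
exists m => //; rewrite reversal_cylinder.
apply/seteqP; split => t /=; rewrite !in_itv/= ler_pdivrMr// ltr_pdivlMr//.
  move=> [tx /andP[t0 t1]]; rewrite -truncn_eq ?mulr_ge0 ?ler0n// -mP.
    exact: (introT eqP tx).
  by rewrite truncn_lt_nat ?mulr_ge0 ?ler0n// gtr_pMl.
move=> mt.
have t0 : 0 <= t by rewrite -(pmulr_lge0 _ R0) (le_trans _ (andP mt).1).
move: mt; rewrite -truncn_eq ?mulr_ge0 ?ler0n// => qm.
have qR : (cell k.+1 t < Rprod r k.+1)%N by rewrite /cell (eqP qm).
split; first by apply/eqP; rewrite mP.
rewrite t0/= -(gtr_pMl _ R0) -truncn_lt_nat ?mulr_ge0 ?ler0n//.
Qed.

Lemma uniform_measure_exists : exists nu : {measure set (borel Y) -> \bar R},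
  forall (x : Y) k, nu (cylinder x k) = (cylradius R r k)%:E.
Proof.
pose leb := mrestr (@lebesgue_measure R) (measurable_itv `[0, 1[).
unshelve eexists (pushforward leb (reversal : measurableTypeR R -> borel Y)
  : {measure set (borel Y) -> \bar R}).
  exact: measurable_reversal.
exact: lebesgue_reversal_cylinder.
Qed.

End reversed_lebesgue.

(** * The identification of the measures *)

Theorem mainTheorem4 (R : realType) (r : nat -> nat)
    (r_ge2 : forall j, (2 <= r j)%N) :
  (forall n : nat,
     hausdorff1 (rhoY R r_ge2) (Yn r_ge2 n)
       = ((Rprod r n)%:R^-1)%:E) /\
  (forall mu0 : {measure set (borel (Y0 r_ge2)) -> \bar R},
     is_haar mu0 -> mu0 setT = 1%E ->
     forall E : set (borel (Y0 r_ge2)), measurable E ->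
       mu0 E = hausdorff1 (rhoY R r_ge2) E).
Proof.
split=> [n|mu0 haar mu0T E mE]; last first.
  apply/esym/hausdorff1_eq => //; first exact: haar_cylinder.
  exact: haar_outer haar E mE.
have [nu nuC] := uniform_measure_exists R r_ge2.
have -> : Yn r_ge2 n = cylinder 0 n.
  by case: n => [|n]; rewrite ?cylinder0 ?cylinderS.
by rewrite (hausdorff1_open nuC) ?nuC//; exact: cylinder_open.
Qed.
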